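(* Let $m\in\mathbb N$ and suppose the non-empty finite sets $A_1,\dots,A_m\subset\mathbb N$ form an $m$-part inclusive sum-and-distance system. For $j\in\{1,\dots,m\}$ let \[\tilde A_j:=\max A_j+\bigl(A_j\cup\{0\}\cup(-A_j)\bigr).\] Then $\tilde A_1,\dots,\tilde A_m$ form an $m$-part sum system in which every component set has odd cardinality. Conversely, suppose $\tilde A_1,\dots,\tilde A_m\subset\mathbb N_0$ form an $m$-part sum system in which every component set has odd cardinality. For each $j$, write the elements of $\tilde A_j$ as $0=\alpha_1<\alpha_2<\dots<\alpha_{2\nu_j+1}$ and let \[A_j:=\{\tfrac12(\alpha_{\nu_j+1+k}-\alpha_{\nu_j+1-k}): k\in\{1,\dots,\nu_j\}\}.\] Then $A_1,\dots,A_m$ form an $m$-part inclusive sum-and-distance system.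
   Context: $\mathbb N=\{1,2,\dots\}$, $\mathbb N_0=\mathbb N\cup\{0\}$, and for $N\in\mathbb N$, $\langle N\rangle:=\{0,1,\dots,N-1\}$. For sets $A,B\subset\mathbb R$ and reals $a,b$: $A+B=\{x+y:x\in A,y\in B\}$, $aA+b=\{ax+b:x\in A\}$, $-A=\{-x:x\in A\}$; $|A|$ is cardinality. An $m$-part sum system is a collection of finite sets $A_1,\dots,A_m\subset\mathbb N_0$, each of cardinality at least 2, with $\sum_{k=1}^m A_k=\langle\prod_{k=1}^m|A_k|\rangle$. Finite sets $A_1,\dots,A_m\subset\mathbb N$ form an $m$-part inclusive sum-and-distance system if \[\sum_{j=1}^m\bigl(A_j\cup\{0\}\cup(-A_j)\bigr)=\Bigl\langle\prod_{j=1}^m(2|A_j|+1)\Bigr\rangle-\tfrac12\Bigl(\prod_{j=1}^m(2|A_j|+1)-1\Bigr).\] *)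

(* Defs.v *)
From HB Require Import structures.
From mathcomp Require Export all_boot all_order all_algebra.
From mathcomp Require Export archimedean finmap reals.

Set Implicit Arguments.
Unset Strict Implicit.
Unset Printing Implicit Defensive.

Import Order.TTheory GRing.Theory Num.Theory.
Local Open Scope fset_scope.
Local Open Scope ring_scope.

Section SumSystems.
Variable R : realType.
Implicit Types A B : {fset R}.

Definition add_fset A B : {fset R} := [fset x + y | x in A, y in B].

Definition sum_fset (m : nat) (A : 'I_m -> {fset R}) : {fset R} :=
  \big[add_fset/[fset 0]]_(j < m) A j.

Definition opp_fset A : {fset R} := [fset - x | x in A].

Definition translate (b : R) A : {fset R} := [fset x + b | x in A].

Definition initial_segment (N : nat) : {fset R} :=
  [fset k%:R | k in iota 0 N].

Definition sum_system (m : nat) (A : 'I_m -> {fset R}) : Prop :=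
  [/\ forall j x, x \in A j -> x \is a Num.nat,
      forall j, (2 <= #|` A j|)%N
    & sum_fset A = initial_segment (\prod_(j < m) #|` A j|)%N].

Definition sym_hull A : {fset R} := A `|` [fset 0] `|` opp_fset A.

Definition inclusive_sum_and_distance_system (m : nat)
    (A : 'I_m -> {fset R}) : Prop :=
  let P := (\prod_(j < m) (2 * #|` A j| + 1))%N in
  (forall j x, x \in A j -> x \is a Num.nat /\ 0 < x) /\
  sum_fset (fun j => sym_hull (A j)) =
    translate (- (2^-1 * (P%:R - 1))) (initial_segment P).

(* The i-th smallest element of A, counted from i = 1; meaningful only for
   1 <= i <= #|` A|. *)
Definition nth_smallest A (i : nat) : R :=
  nth 0 (sort <=%R (enum_fset A)) i.-1.

(* Meaningful only when A is non-empty. *)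
Definition max_fset A : R := nth_smallest A #|` A|.

Definition shifted_hull A : {fset R} := translate (max_fset A) (sym_hull A).

(* For #|` A| = 2 nu + 1, so that nu = #|` A|./2. *)
Definition half_differences A : {fset R} :=
  let nu := #|` A|./2 in
  [fset 2^-1 * (nth_smallest A (nu + 1 + k) - nth_smallest A (nu + 1 - k))
    | k in iota 1 nu].

End SumSystems.

(* Main.v *)
Require Import Defs.
From HB Require Import structures.
From mathcomp Require Import all_boot all_order all_algebra.
From mathcomp Require Import archimedean finmap reals.
From mathcomp Require Import zify lra.

(** Translating a symmetric hull by its maximum turns an inclusive
    sum-and-distance system into a sum system, the total translation being read
    off from the maximum of the sum set.  The converse rests on the symmetry of
    the components of a sum system: [A j] and the sum [B] of the other components
    form a direct sum equal to [[0, N)].  Directness only involves differences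
    within each set, so it survives replacing [A j] by [max (A j) - A j]; the
    new sum still lies in [[0, N)] and has [N] elements, hence equals [A j + B],
    and [B] can be cancelled.  So [A j] is symmetric about its median, and
    centring it there gives the symmetric hull of its half differences. *)

Set Implicit Arguments.
Unset Strict Implicit.
Unset Printing Implicit Defensive.

Import Order.TTheory GRing.Theory Num.Theory.
Local Open Scope fset_scope.
Local Open Scope ring_scope.

(** Two arguments with the same image give equal entries of [map f s] at their indices in [s], so
    these indices coincide. *)
Lemma uniq_map_inj_in (T1 T2 : eqType) (f : T1 -> T2) (s : seq T1) :
  uniq (map f s) -> {in s &, injective f}.
Proof.
move=> us x y xs ys fxy.
have ix : (index x s < size s)%N by rewrite index_mem.
have iy : (index y s < size s)%N by rewrite index_mem.
have : nth (f x) (map f s) (index x s) == nth (f x) (map f s) (index y s).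
  by rewrite !(nth_map x) // !nth_index // fxy.
rewrite nth_uniq ?size_map // => /eqP e.
by rewrite -(nth_index x xs) e nth_index.
Qed.

Section SumSets.
Variable R : realType.
Implicit Types (A B C : {fset R}) (a b x y t : R).

(** * Sumsets, translates and symmetric hulls *)

Lemma add_fsetP x A B :
  reflect (exists2 a, a \in A & exists2 b, b \in B & x = a + b)
          (x \in add_fset A B).
Proof. exact: imfset2P. Qed.

Lemma mem_add_fset A B a b : a \in A -> b \in B -> a + b \in add_fset A B.
Proof. by move=> aA bB; apply/add_fsetP; exists a => //; exists b. Qed.

Lemma add_fsetC : commutative (@add_fset R).
Proof.
move=> A B; apply/fsetP=> x.
by apply/add_fsetP/add_fsetP => -[a aA [b bB ->]];
  exists b => //; exists a; rewrite // addrC.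
Qed.

Lemma add_fsetA : associative (@add_fset R).
Proof.
move=> A B C; apply/fsetP=> x; apply/add_fsetP/add_fsetP.
- move=> [a aA [_ /add_fsetP[b bB [c cC ->]] ->]].
  by exists (a + b); [exact: mem_add_fset | exists c; rewrite // addrA].
- move=> [_ /add_fsetP[a aA [b bB ->]] [c cC ->]].
  by exists a => //; exists (b + c); [exact: mem_add_fset | rewrite addrA].
Qed.

Lemma add0fset : left_id [fset 0] (@add_fset R).
Proof.
move=> A; apply/fsetP=> x; apply/add_fsetP/idP.
- by move=> [a /fset1P-> [b bA ->]]; rewrite add0r.
- by move=> xA; exists 0; [exact/fset1P | exists x; rewrite ?add0r].
Qed.

(** Lets [bigD1] split one component off an iterated sumset. *)
HB.instance Definition _ :=
  Monoid.isComLaw.Build {fset R} [fset 0] (@add_fset R)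
    add_fsetA add_fsetC add0fset.

Lemma translateP x t A :
  reflect (exists2 a, a \in A & x = a + t) (x \in translate t A).
Proof. exact: imfsetP. Qed.

Lemma mem_translate x t A : (x \in translate t A) = (x - t \in A).
Proof.
apply/translateP/idP => [[a aA ->]|xA]; first by rewrite addrK.
by exists (x - t); rewrite ?subrK.
Qed.

Lemma mem_opp_fset x A : (x \in opp_fset A) = (- x \in A).
Proof.
apply/imfsetP/idP => [[a aA ->]|xA]; first by rewrite opprK.
by exists (- x); rewrite ?opprK.
Qed.

Lemma mem_sym_hull x A :
  (x \in sym_hull A) = [|| x \in A, x == 0 | - x \in A].
Proof. by rewrite !inE mem_opp_fset -orbA. Qed.

Lemma mem_initial_segment x N :
  (x \in initial_segment R N) = (x \is a Num.nat) && (x < N%:R).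
Proof.
apply/imfsetP/andP => [[k /=]|[/natrP[k ->]]].
  by rewrite mem_iota add0n => /andP[_ kN] ->; rewrite natr_nat ltr_nat.
by rewrite ltr_nat => kN; exists k; rewrite //= mem_iota.
Qed.

Lemma translate_comp s t A : translate s (translate t A) = translate (t + s) A.
Proof. by apply/fsetP => x; rewrite !mem_translate opprD addrA addrAC. Qed.

Lemma translate0 A : translate 0 A = A.
Proof. by apply/fsetP => x; rewrite mem_translate subr0. Qed.

Lemma card_translate t A : #|` translate t A| = #|` A|.
Proof. by rewrite card_imfset //; exact: addIr. Qed.

Lemma card_opp_fset A : #|` opp_fset A| = #|` A|.
Proof. by rewrite card_imfset //; exact: oppr_inj. Qed.

Lemma natr_sub a b :
  a \is a Num.nat -> b \is a Num.nat -> b <= a -> a - b \is a Num.nat.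
Proof.
by move=> /natrP[i ->] /natrP[j ->]; rewrite ler_nat => ji; rewrite -natrB ?natr_nat.
Qed.

Lemma natr_nonneg a : a \is a Num.nat -> 0 <= a.
Proof. by move=> /natrP[n ->]; exact: ler0n. Qed.

Lemma card_initial_segment N : #|` initial_segment R N| = N.
Proof.
rewrite card_in_imfset /= ?undup_id ?iota_uniq ?size_iota // => i j _ _ /eqP.
by rewrite eqr_nat => /eqP.
Qed.

(** Positivity makes [A], [{0}] and [-A] pairwise disjoint. *)
Lemma card_sym_hull A :
  (forall x, x \in A -> 0 < x) -> #|` sym_hull A| = (2 * #|` A| + 1)%N.
Proof.
move=> A0; have nA0 : 0 \notin A by apply/negP => /A0; rewrite ltxx.
rewrite /sym_hull -fsetUA cardfsU.
rewrite (_ : _ `&` _ = fset0); last first.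
  apply/fsetP => x; rewrite !inE mem_opp_fset; apply/negP => /andP[xA].
  have x0 := A0 _ xA; rewrite gt_eqF //= => /A0; lra.
rewrite cardfsU1 mem_opp_fset oppr0 nA0 card_opp_fset cardfs0; lia.
Qed.

Lemma add_fset_translate s t A B :
  add_fset (translate s A) (translate t B) = translate (s + t) (add_fset A B).
Proof.
apply/fsetP => x; rewrite mem_translate; apply/add_fsetP/add_fsetP.
- move=> [_ /translateP[a aA ->] [_ /translateP[b bB ->] ->]].
  by exists a => //; exists b => //; lra.
- move=> [a aA [b bB e]]; exists (a + s); first by apply/translateP; exists a.
  by exists (b + t); [apply/translateP; exists b | lra].
Qed.

Lemma sum_fset_translate m (t : 'I_m -> R) (A : 'I_m -> {fset R}) :
  sum_fset (fun j => translate (t j) (A j)) =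
  translate (\sum_(j < m) t j) (sum_fset A).
Proof.
rewrite /sum_fset; elim/big_rec3: _ => [|j X s Y _ ->]; first by rewrite translate0.
exact: add_fset_translate.
Qed.

(** * Maxima of sumsets *)

(** Stated as a relation so that maxima of sums and translates need no sorting; computing the
    maximum of one set in two ways then gives an equation. *)
Definition is_max A (M : R) := M \in A /\ forall x, x \in A -> x <= M.

Lemma is_max_inj A M M' : is_max A M -> is_max A M' -> M = M'.
Proof.
by move=> [MA leM] [M'A leM']; apply/eqP; rewrite eq_le leM ?leM'.
Qed.

Lemma is_max_add_fset A B M M' :
  is_max A M -> is_max B M' -> is_max (add_fset A B) (M + M').
Proof.
move=> [MA leM] [M'A leM']; split; first exact: mem_add_fset.
by move=> _ /add_fsetP[a aA [b bB ->]]; apply: lerD; [exact: leM | exact: leM'].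
Qed.

Lemma is_max_sum_fset m (M : 'I_m -> R) (A : 'I_m -> {fset R}) :
  (forall j, is_max (A j) (M j)) -> is_max (sum_fset A) (\sum_(j < m) M j).
Proof.
move=> AM; rewrite /sum_fset; elim/big_rec2: _ => [|j s X _].
  by split=> [|x]; rewrite inE // => /eqP->.
exact: is_max_add_fset.
Qed.

Lemma is_max_translate t A M : is_max A M -> is_max (translate t A) (M + t).
Proof.
move=> [MA leM]; split; first by rewrite mem_translate addrK.
by move=> _ /translateP[a aA ->]; rewrite lerD2r leM.
Qed.

Lemma is_max_initial_segment N :
  (0 < N)%N -> is_max (initial_segment R N) (N%:R - 1).
Proof.
case: N => // N _; rewrite -natr1 addrK; split.
  by rewrite mem_initial_segment natr_nat ltr_nat /=.
move=> x; rewrite mem_initial_segment => /andP[/natrP[k ->]].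
by rewrite ltr_nat ltnS ler_nat.
Qed.

Lemma sorted_sort_fset A : sorted <%R (sort <=%R A).
Proof. by rewrite sort_lt_sorted fset_uniq. Qed.

Lemma size_sort_fset A : size (sort <=%R A) = #|` A|.
Proof. by rewrite size_sort. Qed.

Lemma is_max_max_fset A : A != fset0 -> is_max A (max_fset A).
Proof.
rewrite -cardfs_gt0 /max_fset /nth_smallest => A0.
split; first by rewrite -(mem_sort <=%R) mem_nth // size_sort_fset ltn_predL.
move=> x; rewrite -(mem_sort <=%R) => /(nthP 0)[i]; rewrite size_sort_fset => iA <-.
rewrite lt_sorted_leq_nth ?sorted_sort_fset ?inE ?size_sort_fset //; lia.
Qed.

Lemma is_max_sym_hull A M :
  (forall x, x \in A -> 0 < x) -> is_max A M -> is_max (sym_hull A) M.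
Proof.
move=> A0 [MA leM]; have M0 := A0 _ MA.
split; first by rewrite mem_sym_hull MA.
by move=> x; rewrite mem_sym_hull => /or3P[/leM//|/eqP->|/A0]; lra.
Qed.

(** * Direct sums and reflection *)

Definition direct A B := forall a a' b b',
  a \in A -> a' \in A -> b \in B -> b' \in B -> a + b = a' + b' -> a = a' /\ b = b'.

Lemma card_add_fset A B :
  #|` add_fset A B| = size (undup [seq a + b | a <- A, b <- B]).
Proof. by rewrite /add_fset Imfset.imfset2E size_seq_fset. Qed.

Lemma leq_card_add_fset A B : (#|` add_fset A B| <= #|` A| * #|` B|)%N.
Proof. by rewrite card_add_fset (leq_trans (size_undup _)) // size_allpairs. Qed.

(** The list of all sums has length [#|] A| * #|[B|], and removing duplicates preserves the length
    exactly when no sum occurs twice. *)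
Lemma card_direct A B :
  direct A B <-> #|` add_fset A B| = (#|` A| * #|` B|)%N.
Proof.
rewrite card_add_fset -(size_allpairs (fun a b => a + b)).
split=> [dAB|sz].
  congr size; apply: undup_id; apply: allpairs_uniq; rewrite ?fset_uniq //.
  move=> [a b] [a' b'] /allpairsP[[? ?] /= [aA bB [-> ->]]].
  by move=> /allpairsP[[? ?] /= [a'A b'B [-> ->]]] /dAB[]// -> ->.
have u : uniq [seq a + b | a <- A, b <- B].
  by rewrite -[uniq _]negbK -ltn_size_undup sz ltnn.
move: u; rewrite -(map_allpairs (fun p => p.1 + p.2) (fun a b => (a, b))).
move=> /uniq_map_inj_in inj a a' b b' aA a'A bB b'B e.
have [] : (a, b) = (a', b') by apply: inj => //; apply: allpairs_f.
by [].
Qed.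

Lemma card_sum_fset_le (I : finType) (P : pred I) (A : I -> {fset R}) :
  (#|` \big[@add_fset R/[fset 0%R]]_(j | P j) A j| <= \prod_(j | P j) #|` A j|)%N.
Proof.
elim/big_rec2: _ => [|j n X _ le]; first by rewrite cardfs1.
by rewrite (leq_trans (leq_card_add_fset _ _)) // leq_mul2l le orbT.
Qed.

Definition reflect_fset t A := translate t (opp_fset A).

Lemma mem_reflect_fset x t A : (x \in reflect_fset t A) = (t - x \in A).
Proof. by rewrite mem_translate mem_opp_fset opprB. Qed.

Lemma direct_reflect_fset t A B : direct A B -> direct (reflect_fset t A) B.
Proof.
move=> dAB a a' b b'; rewrite !mem_reflect_fset => aA a'A bB b'B e.
(* Exchanging [a] and [a'] turns the equation into [(t - a') + b = (t - a) + b'], a relation inside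
   [A + B]. *)
have [|e1 e2] := dAB _ _ _ _ a'A aA bB b'B; first lra.
by split; lra.
Qed.

Lemma direct_cancel A A' B :
  (forall x, x \in A -> x \is a Num.nat) ->
  (forall x, x \in A' -> x \is a Num.nat) ->
  (forall x, x \in B -> x \is a Num.nat) ->
  0 \in B -> direct A B -> direct A' B ->
  add_fset A B = add_fset A' B -> A = A'.
Proof.
move=> An A'n Bn B0 dAB dA'B e.
suff main n : (n%:R \in A) = (n%:R \in A').
  apply/fsetP => x; apply/idP/idP => xA.
    by have /natrP[n nx] := An _ xA; move: xA; rewrite nx main.
  by have /natrP[n nx] := A'n _ xA; move: xA; rewrite nx main.
(* The smallest element lying in only one of the two sets would have two
   representations in the direct sum with the other one. *)
have step (C D : {fset R}) k : (forall x, x \in D -> x \is a Num.nat) ->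
    direct C B -> add_fset C B = add_fset D B ->
    (forall i, (i < k)%N -> i%:R \in D -> i%:R \in C) -> k%:R \in C -> k%:R \in D.
  move=> Dn dCB eCD IH kC.
  have : k%:R + 0 \in add_fset D B by rewrite -eCD mem_add_fset.
  move=> /add_fsetP[d dD [b bB]]; rewrite addr0 => kdb.
  have /natrP[i di] := Dn _ dD; have /natrP[l bl] := Bn _ bB.
  have kil : k = (i + l)%N by apply/eqP; rewrite -(eqr_nat R) natrD -di -bl kdb.
  case: l => [|l] in bl kil *; first by rewrite kil addn0 -di.
  have iC : i%:R \in C by apply: IH; [lia | rewrite -di].
  have [|] := dCB _ _ _ _ kC iC B0 bB; first by rewrite addr0 kdb di.
  by move=> _ /eqP; rewrite bl eq_sym pnatr_eq0.
(* Below [n] the two sets agree, so [step] applies in both directions. *)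
elim/ltn_ind: n => n IH; apply/idP/idP; apply: step => // i /IH; by move=> ->.
Qed.

Lemma direct_segment_sym A B N M :
  (forall x, x \in A -> x \is a Num.nat) ->
  (forall x, x \in B -> x \is a Num.nat) ->
  0 \in B -> direct A B -> add_fset A B = initial_segment R N -> is_max A M ->
  reflect_fset M A = A.
Proof.
move=> An Bn B0 dAB e [MA leM].
have rn x : x \in reflect_fset M A -> x \is a Num.nat.
  rewrite mem_reflect_fset => xA.
  by rewrite -(subKr M x) natr_sub ?An ?leM.
have dr := direct_reflect_fset (t := M) dAB.
apply: (direct_cancel (B := B)) => //.
apply/eqP; rewrite eqEfcard; apply/andP; split; last first.
  rewrite (card_direct _ _).1 // (card_direct _ _).1 //.
  by rewrite card_translate card_opp_fset.
apply/fsubsetP => _ /add_fsetP[a ar [b bB ->]].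
rewrite e mem_initial_segment rpredD ?(rn _ ar) ?(Bn _ bB) //=.
(* [M + b] is in the segment, and [a <= M] because [M - a] is an element of [A], hence
   nonnegative. *)
have : M + b \in initial_segment R N by rewrite -e mem_add_fset.
rewrite mem_initial_segment => /andP[_]; apply: le_lt_trans; rewrite lerD2r.
by move: ar; rewrite mem_reflect_fset => /An /natr_nonneg; lra.
Qed.


(** * Symmetry of the components of a sum system *)

Lemma sum_systemD1 m (A : 'I_m -> {fset R}) j : sum_system A ->
  exists B, [/\ forall x, x \in B -> x \is a Num.nat, 0 \in A j, 0 \in B,
    direct (A j) B & add_fset (A j) B = sum_fset A].
Proof.
move=> [An A2 sumA].
pose B := \big[@add_fset R/[fset 0]]_(i | i != j) A i.
have eB : add_fset (A j) B = sum_fset A by rewrite /sum_fset (bigD1 j).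
have Bn x : x \in B -> x \is a Num.nat.
  rewrite /B; elim/big_ind: _ x => [x|X Y Xn Yn x|i _ x].
  - by rewrite inE => /eqP->; rewrite rpred0.
  - by move=> /add_fsetP[a /Xn aX [b /Yn bY ->]]; rewrite rpredD.
  - exact: An.
(* Two nonnegative summands adding up to 0 both vanish, which puts 0 in both sets. *)
have : 0 \in add_fset (A j) B.
  rewrite eB sumA mem_initial_segment rpred0 ltr0n prodn_gt0 // => i.
  exact: ltnW.
move=> /add_fsetP[a aA [b bB ab]].
have a0 := natr_nonneg (An _ _ aA); have b0 := natr_nonneg (Bn _ bB).
have a00 : a = 0 by lra.
have b00 : b = 0 by lra.
rewrite a00 in aA; rewrite b00 in bB.
(* Directness by counting: [A j + B] has as many elements as the product of all cardinalities, which
   bounds [#|] A j| * #|[B|] from above. *)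
exists B; split=> //; apply: (card_direct _ _).2; apply: anti_leq.
rewrite leq_card_add_fset /= eB sumA card_initial_segment (bigD1 j) //=.
by rewrite leq_mul2l card_sum_fset_le orbT.
Qed.

Lemma sum_system_mem0 m (A : 'I_m -> {fset R}) j : sum_system A -> 0 \in A j.
Proof. by move=> /(sum_systemD1 j)[B []]. Qed.

Lemma sum_system_sym m (A : 'I_m -> {fset R}) j M :
  sum_system A -> is_max (A j) M -> reflect_fset M (A j) = A j.
Proof.
move=> sA; have [B [Bn _ B0 dAB eB]] := sum_systemD1 j sA.
have [An _ sumA] := sA.
exact: direct_segment_sym (An j) Bn B0 dAB (etrans eB sumA).
Qed.

(** * Symmetric sets of odd cardinality *)

(** The map [x -> M - x] reverses the order, so it sends the sorted list to its own reversal. *)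
Lemma nth_sort_reflect A M i : reflect_fset M A = A -> (i < #|` A|)%N ->
  nth 0 (sort <=%R A) (#|` A| - i.+1) = M - nth 0 (sort <=%R A) i.
Proof.
move=> symA iA; set s := sort _ _.
have es : s = rev [seq M - x | x <- s].
  apply: lt_sorted_eq; first exact: sorted_sort_fset.
    rewrite rev_sorted sorted_map; apply: sub_sorted (sorted_sort_fset A).
    by move=> x y /= xy; rewrite ltrD2l ltrN2.
  move=> x; rewrite mem_rev mem_sort -{1}symA mem_reflect_fset.
  apply/idP/mapP => [xA|[y + ->]]; last by rewrite mem_sort subKr.
  by exists (M - x); rewrite ?mem_sort ?subKr.
rewrite {1}es nth_rev size_map size_sort_fset ?(nth_map 0) ?size_sort_fset; try lia.
by congr (M - nth _ _ _); lia.
Qed.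

(** Indices start at 0: for cardinality [2 nu + 1] this is the entry at position [nu], the middle
    one. *)
Definition median A := nth 0 (sort <=%R A) #|` A|./2.

Section OddSymmetric.
Variables (A : {fset R}) (M : R).
Hypotheses (symA : reflect_fset M A = A) (oddA : odd #|` A|).

Lemma median_mem : median A \in A.
Proof. by rewrite -(mem_sort <=%R) mem_nth // size_sort_fset; lia. Qed.

(** The reflection fixes the middle position, so the median is its own mirror image. *)
Lemma median_double : M = 2 * median A.
Proof.
have := @nth_sort_reflect _ _ #|` A|./2 symA.
rewrite (_ : (_ - _)%N = #|` A|./2); last lia.
by rewrite -/(median A) => /(_ ltac:(lia)); lra.
Qed.

(** The two elements at rank distance [k] from the median are mirror images, so half their
    difference is the distance of the upper one from the median. *)
Lemma mem_half_differences x :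
  (x \in half_differences A) = (x + median A \in A) && (0 < x).
Proof.
have nth_half k : (k <= #|` A|./2)%N ->
    2^-1 * (nth_smallest A (#|` A|./2 + 1 + k) - nth_smallest A (#|` A|./2 + 1 - k))
    = nth 0 (sort <=%R A) (#|` A|./2 + k) - median A.
  move=> kn; rewrite /nth_smallest.
  have := @nth_sort_reflect _ _ (#|` A|./2 + k) symA ltac:(lia).
  rewrite (_ : (#|` A| - _)%N = (#|` A|./2 + 1 - k).-1); last lia.
  rewrite (_ : (#|` A|./2 + 1 + k).-1 = (#|` A|./2 + k)%N); last lia.
  move=> ->; rewrite median_double; lra.
apply/imfsetP/andP => /= [[k]|[]].
  rewrite mem_iota => kn ->; rewrite nth_half; last lia.
  rewrite subrK -(mem_sort <=%R) mem_nth ?size_sort_fset; last lia.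
  by rewrite subr_gt0 lt_sorted_ltn_nth ?sorted_sort_fset ?inE ?size_sort_fset; lia.
rewrite -{1}(mem_sort <=%R) => /(nthP 0)[i]; rewrite size_sort_fset => iA xi x0.
have : median A < nth 0 (sort <=%R A) i by rewrite xi; lra.
rewrite lt_sorted_ltn_nth ?sorted_sort_fset ?inE ?size_sort_fset; try lia.
(* The witness [k] is the rank distance of [x + median A] from the median. *)
move=> lti; have ki : (1 <= i - #|` A|./2 < 1 + #|` A|./2)%N by lia.
exists (i - #|` A|./2)%N; first by rewrite mem_iota.
by rewrite nth_half ?subnKC ?xi ?addrK //; lia.
Qed.

(** Sort the centred set by sign: its positive elements are the half differences, its negative ones
    their opposites by symmetry, and 0 comes from the median. *)
Lemma sym_hull_half_differences :
  sym_hull (half_differences A) = translate (- median A) A.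
Proof.
apply/fsetP => x; rewrite mem_sym_hull !mem_half_differences mem_translate opprK.
have -> : (- x + median A \in A) = (x + median A \in A).
  have symE y : (M - y \in A) = (y \in A) by rewrite -mem_reflect_fset symA.
  by rewrite -symE; congr (in_mem _ _); rewrite median_double; lra.
rewrite oppr_gt0; case: (ltgtP x 0) => [_|_|->].
- by rewrite andbF andbT.
- by rewrite andbF andbT /= orbF.
- by rewrite add0r median_mem orbT.
Qed.

Lemma card_half_differences : (2 * #|` half_differences A| + 1)%N = #|` A|.
Proof.
rewrite -card_sym_hull; first by rewrite sym_hull_half_differences card_translate.
by move=> x; rewrite mem_half_differences => /andP[].
Qed.

End OddSymmetric.

(** * The two directions of the correspondence *)

Lemma inclusive_system_shifted_hull m (A : 'I_m -> {fset R}) :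
  (forall j, A j != fset0) -> inclusive_sum_and_distance_system A ->
  sum_system (fun j => shifted_hull (A j)) /\
  (forall j, odd #|` shifted_hull (A j)|).
Proof.
move=> A0 [Apos sumA].
have A_gt0 j x : x \in A j -> 0 < x by move=> /Apos[].
have card_hull j : #|` shifted_hull (A j)| = (2 * #|` A j| + 1)%N.
  by rewrite card_translate card_sym_hull //; exact: A_gt0.
have maxA j := is_max_max_fset (A0 j).
split; last by move=> j; rewrite card_hull; lia.
split=> [j x|j|].
- rewrite mem_translate mem_sym_hull => xA; have [MA leM] := maxA j.
  have [/= Mn M0] := Apos _ _ MA; rewrite -(subrK (max_fset (A j)) x).
  case/or3P: xA => [/Apos[xn _]|/eqP->|yA]; first by rewrite rpredD.
    by rewrite add0r.
  by rewrite addrC -[x - _]opprK natr_sub ?leM //; have [] := Apos _ _ yA.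
- by rewrite card_hull; have := A0 j; rewrite -cardfs_gt0; lia.
- set P := (\prod_(j < m) (2 * #|` A j| + 1))%N in sumA.
  have -> : (\prod_(j < m) #|` shifted_hull (A j)|)%N = P.
    by apply: eq_bigr => j _; exact: card_hull.
  have P0 : (0 < P)%N by apply: prodn_gt0 => j; rewrite addn1.
  (* The sum of the hulls has maximum the sum of the [max_fset (A j)]; as a centred segment it has
     maximum [(P - 1) / 2]. So the total translation undoes the centring. *)
  have := is_max_sum_fset (fun j => is_max_sym_hull (@A_gt0 j) (maxA j)).
  have := is_max_translate (- (2^-1 * (P%:R - 1))) (is_max_initial_segment P0).
  rewrite -sumA => /is_max_inj max_eq /max_eq sum_max.
  rewrite sum_fset_translate sumA translate_comp -sum_max -[RHS]translate0.
  by congr translate; lra.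
Qed.

Lemma sum_system_half_differences m (A : 'I_m -> {fset R}) :
  sum_system A -> (forall j, odd #|` A j|) ->
  inclusive_sum_and_distance_system (fun j => half_differences (A j)).
Proof.
move=> sA oddA; have [An A2 sumA] := sA.
have maxA j : is_max (A j) (max_fset (A j)).
  by apply: is_max_max_fset; rewrite -cardfs_gt0 ltnW.
have symA j := sum_system_sym sA (maxA j).
split=> [j x|].
  rewrite (mem_half_differences (symA j)) // => /andP[xA x0]; split=> //.
  (* [x] is a difference of two elements of [A j], hence an integer despite the factor one half. *)
  rewrite -(addrK (median (A j)) x) natr_sub ?(An j) ?median_mem //; lra.
set P := (\prod_(j < m) _)%N.
have PE : P = (\prod_(j < m) #|` A j|)%N.
  by apply: eq_bigr => j _; exact: card_half_differences (symA j) _.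
have P0 : (0 < P)%N by apply: prodn_gt0 => j; lia.
have -> : sum_fset (fun j => sym_hull (half_differences (A j))) =
          sum_fset (fun j => translate (- median (A j)) (A j)).
  by apply: eq_bigr => j _; exact: sym_hull_half_differences (symA j) _.
rewrite sum_fset_translate sumA -PE; congr translate.
(* The maxima add up to [P - 1] and each is twice a median, so the medians add up to
   [(P - 1) / 2]. *)
have := is_max_sum_fset maxA.
rewrite sumA -PE => /is_max_inj/(_ (is_max_initial_segment P0)) <-.
rewrite mulr_sumr -sumrN; apply: eq_bigr => j _.
rewrite (median_double (symA j)) //; lra.
Qed.

Lemma sum_system_nth_smallest1 m (A : 'I_m -> {fset R}) j :
  sum_system A -> nth_smallest (A j) 1 = 0.
Proof.
move=> sA; have [An A2 _] := sA; have := sum_system_mem0 j sA.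
rewrite -(mem_sort <=%R) => /(nthP 0)[i iA i0].
have sz : (0 < size (sort <=%R (A j)))%N by rewrite size_sort_fset ltnW.
have fA : nth_smallest (A j) 1 \in A j by rewrite -(mem_sort <=%R) mem_nth.
apply/eqP; rewrite eq_le (natr_nonneg (An _ _ fA)) andbT -i0 /nth_smallest.
by rewrite lt_sorted_leq_nth ?sorted_sort_fset.
Qed.

End SumSets.

Theorem theorem3 (R : realType) (m : nat) (hm : (0 < m)%N) :
  (forall A : 'I_m -> {fset R},
     (forall j, A j != fset0) ->
     inclusive_sum_and_distance_system A ->
     sum_system (fun j => shifted_hull (A j)) /\
     (forall j, odd #|` shifted_hull (A j)|))
  /\
  (forall At : 'I_m -> {fset R},
     sum_system At ->
     (forall j, odd #|` At j|) ->
     (forall j, nth_smallest (At j) 1 = 0) /\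
     inclusive_sum_and_distance_system (fun j => half_differences (At j))).
Proof.
split=> [A|At sAt oddAt]; first exact: inclusive_system_shifted_hull.
split=> [j|]; first exact: sum_system_nth_smallest1.
exact: sum_system_half_differences.
Qed.
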